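(* Let $\Gamma=(V,E,L)$ be a labeled digraph. (a) $\Gamma$ is the labeled Cayley digraph of a right-cancellative magma if and only if $\Gamma$ is deterministic, source-complete, and codeterministic. (b) $\Gamma$ is the labeled Cayley digraph of a right-divisible magma if and only if $\Gamma$ is deterministic, source-complete, and target-complete. (c) $\Gamma$ is the labeled Cayley digraph of a right quasigroup if and only if $\Gamma$ is deterministic, source-complete, codeterministic, and target-complete.
   Context: A magma $V_R$ is a pair $(V,R)$ where $V$ is a set and $R$ assigns to each $v\in V$ a function $R_v:V\to V$. It is right-cancellative (resp. right-divisible) if every $R_v$ is injective (resp. surjective), and a right quasigroup if every $R_v$ is a permutation of $V$. A labeled digraph is a triple $\Gamma=(V,E,L)$ where $V$ is a set (of vertices), $L\subseteq V$ is a subset (of labels), and $E\subseteq V\times L\times V$. Let $\pi_1:E\to V\times L$ and $\pi_2:E\to L\times V$ be the projections onto the first two and last two coordinates. $\Gamma$ is deterministic (resp. codeterministic) if $\pi_1$ (resp. $\pi_2$) is injective, and source-complete (resp. target-complete) if $\pi_1$ (resp. $\pi_2$) is surjective. The labeled Cayley digraph of a magma $V_R$ with respect to a connection set $S\subseteq V$ is the labeled digraph $\Gamma_{\mathrm{lab}}(V_R,S)=(V,E,S)$ with $E=\{(v,s,R_s(v))\mid v\in V,\ s\in S\}$. ''$\Gamma$ is the labeled Cayley digraph of a magma of a given class'' means $\Gamma=\Gamma_{\mathrm{lab}}(V_R,S)$ for some magma $V_R$ in that class and some $S\subseteq V$. *)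

(* Defs.v *)
From mathcomp Require Import all_boot.
From mathcomp Require Import boolp classical_sets functions.

Set Implicit Arguments.
Unset Strict Implicit.
Unset Printing Implicit Defensive.

Local Open Scope classical_set_scope.

(* [R v] is the right translation u |-> R_v(u). *)
Definition magma (V : Type) := V -> V -> V.

Section Magmas.
Variables (V : Type) (R : magma V).

Definition right_cancellative := forall v, injective (R v).

Definition right_divisible := forall v, set_surj [set: V] [set: V] (R v).

Definition right_quasigroup := forall v, bijective (R v).

End Magmas.

(* An edge (v, l, w) goes from v to w and carries the label l. *)
Record labeled_digraph (V : Type) := LabeledDigraph {
  labels : set V;
  edges : set (V * V * V);
  edges_sub : edges `<=` [set: V] `*` labels `*` [set: V]
}.

Section LabeledDigraphs.
Variables (V : Type) (G : labeled_digraph V).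

Definition pi1 (e : V * V * V) : V * V := (e.1.1, e.1.2).
Definition pi2 (e : V * V * V) : V * V := (e.1.2, e.2).

Definition deterministic := set_inj (edges G) pi1.

Definition codeterministic := set_inj (edges G) pi2.

Definition source_complete := set_surj (edges G) ([set: V] `*` labels G) pi1.

Definition target_complete := set_surj (edges G) (labels G `*` [set: V]) pi2.

End LabeledDigraphs.

Section LabeledCayley.
Variable V : Type.

Definition Cayley_edges (R : magma V) (S : set V) : set (V * V * V) :=
  [set (v, s, R s v) | v in [set: V] & s in S].

Lemma Cayley_edges_sub (R : magma V) (S : set V) :
  Cayley_edges R S `<=` [set: V] `*` S `*` [set: V].
Proof. by move=> _ [v _ [s Ss <-]]. Qed.

Definition labeled_Cayley (R : magma V) (S : set V) : labeled_digraph V :=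
  LabeledDigraph (@Cayley_edges_sub R S).

(* Since [edges_sub] is a proof, digraphs on [V] are equal iff their label sets
   and edge sets are. The class [C] only needs to range over magmas on [V]: a
   labeled Cayley digraph has the same vertex set as its magma. *)
Definition labeled_Cayley_of (C : magma V -> Prop) (G : labeled_digraph V) :=
  exists (R : magma V) (S : set V), C R /\ G = labeled_Cayley R S.

End LabeledCayley.

(* Main.v *)
(** In the labeled Cayley digraph of [R] and [S], the edges labeled [s] form the
    graph of [R s], so codeterminism and target-completeness say that [R s] is
    injective, resp. surjective, for every [s] in [S]. Conversely, the edges of a
    deterministic source-complete digraph labeled [s] form the graph of a function
    [R s] for each label [s]; taking [R s] to be the identity when [s] is not a
    label puts no further constraint on the magma. *)
Require Import Defs.
From mathcomp Require Import all_boot.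
From mathcomp Require Import boolp classical_sets functions.

Lemma labeled_digraph_eq (V : Type) (G H : labeled_digraph V) :
  labels G = labels H -> edges G = edges H -> G = H.
Proof.
case: G H => [L E subG] [M F subH] /= eqL eqE.
by subst M F; rewrite (Prop_irrelevance subG subH).
Qed.

Lemma Cayley_edgesE (V : Type) (R : magma V) (S : set V) (v s w : V) :
  Cayley_edges R S (v, s, w) <-> S s /\ R s v = w.
Proof.
split=> [[x _ [t St [<- <- <-]]] //|[Ss <-]].
by exists v => //; exists s.
Qed.

Lemma labeled_Cayley_deterministic (V : Type) (R : magma V) (S : set V) :
  deterministic (labeled_Cayley R S).
Proof.
move=> [[v s] w] [[x t] y] /set_mem /Cayley_edgesE [_ <-].
by move=> /set_mem /Cayley_edgesE [_ <-] [/= -> ->].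
Qed.

Lemma labeled_Cayley_source_complete (V : Type) (R : magma V) (S : set V) :
  source_complete (labeled_Cayley R S).
Proof.
by move=> [v s] [_ /= Ss]; exists (v, s, R s v) => //; apply/Cayley_edgesE.
Qed.

(** Two edges with a common label and target have the form [(v, s, R s v)] and [(x, s, R s x)] with
    [R s v = R s x]. *)
Lemma labeled_Cayley_codeterministicP (V : Type) (R : magma V) (S : set V) :
  codeterministic (labeled_Cayley R S) <-> forall s, S s -> injective (R s).
Proof.
split=> [coG s Ss v x eqR|injR [[v s] w] [[x t] y]].
  have E1 : Cayley_edges R S (v, s, R s v) by apply/Cayley_edgesE.
  have E2 : Cayley_edges R S (x, s, R s v) by apply/Cayley_edgesE.
  by case: (coG _ _ (mem_set E1) (mem_set E2) erefl).
move=> /set_mem /Cayley_edgesE [Ss eqw] /set_mem /Cayley_edgesE [_ eqy].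
case=> /= eqs wy; rewrite -{}eqs -{}wy in eqy *; congr (_, _, _).
by apply: (injR s Ss); rewrite eqw eqy.
Qed.

Lemma labeled_Cayley_target_completeP (V : Type) (R : magma V) (S : set V) :
  target_complete (labeled_Cayley R S) <->
  forall s, S s -> set_surj [set: V] [set: V] (R s).
Proof.
split=> [tcG s Ss w _|surjR [s w] [/= Ss _]].
  by have [//|[[v t] y] /Cayley_edgesE [_ <-] [/= -> <-]] := tcG (s, w); exists v.
have [v _ eqw] := surjR s Ss w Logic.I.
by exists (v, s, w) => //; apply/Cayley_edgesE.
Qed.

(** Choosing a preimage of each point gives a right inverse of [f]; injectivity makes it a left
    inverse too. *)
Lemma bijective_inj_surj (V : Type) (f : V -> V) :
  bijective f <-> injective f /\ set_surj [set: V] [set: V] f.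
Proof.
split=> [bijf|[injf surjf]].
  split; first exact: bij_inj.
  by case: bijf => g _ gK w _; exists (g w).
have /choice [g gK] : forall w, exists v, f v = w.
  by move=> w; have [//|v _ <-] := surjf w; exists v.
by exists g => // v; apply: injf; rewrite gK.
Qed.

(** Source-completeness yields an edge for each vertex and label, and determinism makes its target
    unique; this target is the value of [R s]. *)
Lemma exists_labeled_Cayley (V : Type) (G : labeled_digraph V) :
  deterministic G -> source_complete G ->
  exists R : magma V, G = labeled_Cayley R (labels G) /\
    forall s, ~ labels G s -> R s = id.
Proof.
move=> detG scG.
(* The pair [sv] lists the label first, the reverse of [pi1]. When [sv.1] is not a label, the value
   defaults to the vertex [sv.2], which gives the identity. *)
have /choice [r rP] : forall sv : V * V, exists w,
    (labels G sv.1 -> edges G (sv.2, sv.1, w)) /\ (~ labels G sv.1 -> w = sv.2).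
  move=> [s v] /=; have [Ls|nLs] := pselect (labels G s); last by exists v.
  have [//|[[x t] w] Ew [/= eqx eqt]] := scG (v, s).
  by rewrite eqx eqt in Ew; exists w.
exists (fun s v => r (s, v)); split; last first.
  by move=> s nLs; apply/funext => v; exact: (rP (s, v)).2.
apply: labeled_digraph_eq => //; apply/seteqP; split=> [[[v s] w] Ew|].
  have [[_ Ls] _] := edges_sub Ew.
  apply/Cayley_edgesE; split=> //.
  (* The chosen edge and the given one share source [v] and label [s], so determinism identifies
     them. *)
  have /= Er := (rP (s, v)).1 Ls.
  by case: (detG _ _ (mem_set Er) (mem_set Ew) erefl).
by move=> [[v s] w] /Cayley_edgesE [Ls <-]; exact: (rP (s, v)).1.
Qed.

(** Common form of the three equivalences: [P] constrains each translation, [Q] the digraph. The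
    hypothesis [P id] covers translations by non-labels. *)
Lemma labeled_Cayley_ofP (V : Type) (P : (V -> V) -> Prop)
    (Q : labeled_digraph V -> Prop) (G : labeled_digraph V) :
  P id ->
  (forall R S, Q (labeled_Cayley R S) <-> forall s, S s -> P (R s)) ->
  labeled_Cayley_of (fun R => forall v, P (R v)) G <->
  deterministic G /\ source_complete G /\ Q G.
Proof.
move=> Pid QP; split=> [[R [S [PR ->]]]|[detG [scG QG]]].
  split; first exact: labeled_Cayley_deterministic.
  by split; [exact: labeled_Cayley_source_complete|apply/QP].
have [R [eqG Rid]] := exists_labeled_Cayley _ _ detG scG.
exists R, (labels G); split=> // s.
have [Ls|/Rid -> //] := pselect (labels G s).
(* Through [eqG], [Q G] becomes a statement on a Cayley digraph, to which [QP] applies. *)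
by move: QG; rewrite eqG => /QP; apply.
Qed.

Theorem theorem7p12 (V : Type) (G : labeled_digraph V) :
  (labeled_Cayley_of (@right_cancellative V) G <->
     deterministic G /\ source_complete G /\ codeterministic G) /\
  (labeled_Cayley_of (@right_divisible V) G <->
     deterministic G /\ source_complete G /\ target_complete G) /\
  (labeled_Cayley_of (@right_quasigroup V) G <->
     deterministic G /\ source_complete G /\
     codeterministic G /\ target_complete G).
Proof.
split; [|split].
- apply: (labeled_Cayley_ofP V (@injective V V) (@codeterministic V)) => // R S.
  exact: labeled_Cayley_codeterministicP.
- apply: (labeled_Cayley_ofP V (set_surj [set: V] [set: V])
    (@target_complete V)).
    by move=> v _; exists v.
  exact: labeled_Cayley_target_completeP.
- apply: (labeled_Cayley_ofP V (@bijective V V)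
    (fun H => codeterministic H /\ target_complete H)).
    by exists id.
  move=> R S; rewrite labeled_Cayley_codeterministicP.
  rewrite labeled_Cayley_target_completeP; split=> [[injR surjR] s Ss|bijR].
    by apply/bijective_inj_surj; split; [exact: injR|exact: surjR].
  by split=> s /bijR /bijective_inj_surj [].
Qed.
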